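(* Let $\mathcal{D}$ be the collection of semigroup inclusion classes listed in the context, ordered by inclusion. For any $n \ge 1$, if $\alpha=(A_1,A_2,\dots,A_n,A_{n+1})$ is an $n$-path from $A_1$ to $A_{n+1}$ in $\mathcal{D}$ and $X$ is a semigroup inclusion class with $A_1 < X < A_{n+1}$, then $X \in \mathcal{D}$. If $n=1$ then $A_2$ covers $A_1$.
   Context: Semigroups are nonempty. Let $L_k, M_k$ ($1\le k\le t$) be finite nonempty sets of nonempty words over an alphabet of variables. The semigroup inclusion class $[L_1\subseteq M_1;\dots;L_t\subseteq M_t]$ is the class of all semigroups $S$ such that, for every assignment of elements of $S$ to the variables and every $k$, the set of values in $S$ of the words of $L_k$ is contained in the set of values of the words of $M_k$. One writes $u\in\{v_1,\dots,v_m\}$ for $\{u\}\subseteq\{v_1,\dots,v_m\}$ and $u=v$ for $\{u\}\subseteq\{v\}$. Distinct letters are distinct, independently universally quantified variables. Union means union of classes of semigroups. The semigroup inclusion classes form a lattice ordered by inclusion, and $A<B$ means that $A$ is properly contained in $B$. A sequence $\alpha=(A_1,A_2,\dots,A_n,A_{n+1})$ of $n+1$ distinct points is an $n$-path from $A_1$ to $A_{n+1}$ if $A_1<A_2<\dots<A_n<A_{n+1}$; it is an $n$-path in $\mathcal{D}$ if all its terms belong to $\mathcal{D}$. For two distinct points $A,B$ of the lattice of semigroup inclusion classes, $B$ covers $A$ if $(A,B)$ is a 1-path from $A$ to $B$ and, for any $X$ in that lattice, $A<X<B$ implies $X\in\{A,B\}$ (that is, no semigroup inclusion class lies strictly between $A$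 and $B$). Notation: $0$ is the class of one-element semigroups; $Z=[xy=zw]$; $L=[xy=x]$; $R=[xy=y]$; $IL=[xyz=xw]$; $IR=[xyz=wz]$; $GL=[xyz=xy]$; $GR=[xyz=yz]$; $RB=[xyx=x]$ (rectangular bands); $IRB=[xyz=xz]$; $GRB_l=[xyz=xywz;\ xy=xyxy]$; $GRB_r=[xyz=xwyz;\ xy=xyxy]$. The collection $\mathcal{D}$ consists of the following classes: $0$, $L$, $R$, $L\cup R$, $Z$, $L\cup Z$, $Z\cup R$, $L\cup Z\cup R$; $IL$, $IR$, $IL\cup R$, $L\cup IR$, $IL\cup IR$, $GL$, $GR$, $GL\cup R$, $L\cup GR$, $GL\cup IR$, $IL\cup GR$, $GL\cup GR$; $RB$, $Z\cup RB$, $IL\cup RB$, $RB\cup IR$, $IL\cup RB\cup IR$, $GL\cup RB$, $RB\cup GR$, $GL\cup RB\cup IR$, $IL\cup RB\cup GR$, $GL\cup RB\cup GR$; $IRB$, $GL\cup IRB$, $IRB\cup GR$, $GL\cup IRB\cup GR$; $GRB_l$, $GRB_r$, $GRB_l\cup GR$, $GL\cup GRB_r$, $GRB_l\cup GRB_r$.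
   Formalization: The last sentence is false for arbitrary 1-paths in D, e.g. (0, L∪R), since 0 < L < L∪R; it is proved under the added hypothesis that A_2 covers A_1 within D (no member of D lies strictly between them), with the conclusion that A_2 covers A_1 in the whole lattice. *)

(* Defs.v *)
From HB Require Import structures.
From mathcomp Require Import all_boot.
From mathcomp Require Import finmap boolp classical_sets.

Set Implicit Arguments.
Unset Strict Implicit.
Unset Printing Implicit Defensive.

Local Open Scope classical_set_scope.

(* [semigroupType] itself cannot be bundled here: [set semigroup] below would
   be universe inconsistent, and its carrier may be empty. The instances make
   every carrier a [semigroupType]; the choice operator that this requires comes
   from classical choice and is used by no definition. *)
Record semigroup := MkSemigroup {
  carrier :> Type;
  semigroup_mul : carrier -> carrier -> carrier;
  semigroup_mulA : associative semigroup_mul;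
  carrier_inhabited : inhabited carrier }.

HB.instance Definition _ (S : semigroup) := gen_eqMixin (carrier S).
HB.instance Definition _ (S : semigroup) := gen_choiceMixin (carrier S).
HB.instance Definition _ (S : semigroup) :=
  isSemigroup.Build (carrier S) (@semigroup_mulA S).

(* Variables are natural numbers; a nonempty word is its first letter together
   with the sequence of the remaining ones. *)
Definition word : Type := (nat * seq nat)%type.
HB.instance Definition _ := Choice.on word.

Definition letter (i : nat) : word := (i, [::]).

Definition wcat (u v : word) : word := (u.1, u.2 ++ v.1 :: v.2).

Declare Scope word_scope.
Delimit Scope word_scope with W.
Bind Scope word_scope with word.
Notation "u * v" := (wcat u v) : word_scope.

Definition value (S : semigroup) (f : nat -> S) (u : word) : S :=
  foldl (fun a i => (a * f i)%g) (f u.1) u.2.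

(* The pair (L, M) stands for the inclusion "L \subseteq M". *)
Definition inclusion : Type := ({fset word} * {fset word})%type.

Definition satisfies (S : semigroup) (c : inclusion) : Prop :=
  forall f : nat -> S,
    value f @` [set` c.1] `<=` value f @` [set` c.2].

Definition incl_class (s : seq inclusion) : set semigroup :=
  [set S | forall c, c \in s -> satisfies S c].

Definition semigroup_inclusion_class (A : set semigroup) : Prop :=
  exists s : seq inclusion,
    [/\ s <> [::],
        forall c, c \in s -> c.1 != fset0 /\ c.2 != fset0
      & A = incl_class s].

Definition identity (u v : word) : inclusion := ([fset u]%fset, [fset v]%fset).
Notation "u ≐ v" := (identity u%W v%W) (at level 70, no associativity).

Local Notation "''x'" := (letter 0) (at level 0).
Local Notation "''y'" := (letter 1) (at level 0).
Local Notation "''z'" := (letter 2) (at level 0).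
Local Notation "''w'" := (letter 3) (at level 0).

Definition trivial_class : set semigroup :=
  [set S | exists a : S, forall b : S, b = a].
Definition Zc := incl_class [:: 'x * 'y ≐ 'z * 'w].
Definition Lc := incl_class [:: 'x * 'y ≐ 'x].
Definition Rc := incl_class [:: 'x * 'y ≐ 'y].
Definition IL := incl_class [:: 'x * 'y * 'z ≐ 'x * 'w].
Definition IR := incl_class [:: 'x * 'y * 'z ≐ 'w * 'z].
Definition GL := incl_class [:: 'x * 'y * 'z ≐ 'x * 'y].
Definition GR := incl_class [:: 'x * 'y * 'z ≐ 'y * 'z].
Definition RB := incl_class [:: 'x * 'y * 'x ≐ 'x].
Definition IRB := incl_class [:: 'x * 'y * 'z ≐ 'x * 'z].
Definition GRBl := incl_class
  [:: 'x * 'y * 'z ≐ 'x * 'y * 'w * 'z; 'x * 'y ≐ 'x * 'y * 'x * 'y].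
Definition GRBr := incl_class
  [:: 'x * 'y * 'z ≐ 'x * 'w * 'y * 'z; 'x * 'y ≐ 'x * 'y * 'x * 'y].

Definition collD : set (set semigroup) :=
  [set trivial_class; Lc; Rc; Lc `|` Rc;
       Zc; Lc `|` Zc; Zc `|` Rc; Lc `|` Zc `|` Rc;
       IL; IR; IL `|` Rc; Lc `|` IR; IL `|` IR;
       GL; GR; GL `|` Rc; Lc `|` GR; GL `|` IR; IL `|` GR; GL `|` GR;
       RB; Zc `|` RB; IL `|` RB; RB `|` IR; IL `|` RB `|` IR;
       GL `|` RB; RB `|` GR; GL `|` RB `|` IR; IL `|` RB `|` GR;
       GL `|` RB `|` GR;
       IRB; GL `|` IRB; IRB `|` GR; GL `|` IRB `|` GR;
       GRBl; GRBr; GRBl `|` GR; GL `|` GRBr; GRBl `|` GRBr].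

(* The i-th point of the path is [alpha] at the ordinal i - 1. *)
Definition is_path (n : nat) (alpha : 'I_n.+1 -> set semigroup) : Prop :=
  injective alpha /\
  forall i j : 'I_n.+1, j = i.+1 :> nat -> alpha i `<` alpha j.

Definition path_in (E : set (set semigroup)) (n : nat)
    (alpha : 'I_n.+1 -> set semigroup) : Prop :=
  is_path alpha /\ forall i, E (alpha i).

(* For [E := collD] this says that (A, B) is an edge of the Hasse diagram of
   [collD]; covering in the whole lattice is [covers] below. *)
Definition covers_in (E : set (set semigroup)) (B A : set semigroup) : Prop :=
  [/\ E A, E B, A `<` B
    & forall X, E X -> A `<` X -> X `<` B -> X = A \/ X = B].

Definition covers (B A : set semigroup) : Prop :=
  covers_in semigroup_inclusion_class B A.

(* Main.v *)
Require Import Defs.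
From HB Require Import structures.
From mathcomp Require Import all_boot.
From mathcomp Require Import finmap boolp classical_sets.

(**
Call S generic in a class J when every word u has an assignment into S such
that any word taking the same value as u is equal to u throughout J. If a member
of an inclusion class X is generic in J, then J is contained in X. Ordered by
inclusion, twelve of the given classes (0, L, R, Z, IL, IR, GL, GR, RB, IRB,
GRB_l, GRB_r) suffice: every semigroup in GRB_l \cup GRB_r is generic in the
least of them that contains it. So each inclusion class below GRB_l \cup GRB_r
is a union of a down-closed set of these twelve, and there are 39 such sets.

Conversely, each of the twelve classes J other than 0 comes with one inclusion
that fails in every semigroup generic in J and holds in every class of the
twelve that does not contain J. Adding such inclusions to a definition of
GRB_l \cup GRB_r defines each of the 39 unions, so all of them are inclusion
classes. This is needed for the covering relation to make sense in the lattice.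
*)

Set Implicit Arguments.
Unset Strict Implicit.
Unset Printing Implicit Defensive.

Local Open Scope classical_set_scope.

(** * Inclusions with a single word on the left *)

Definition among (u : word) (vs : seq word) : inclusion :=
  ([fset u]%fset, [fset v in vs]%fset).

Lemma satisfies_amongP (S : semigroup) u vs :
  satisfies S (among u vs) <->
  forall f : nat -> S, exists2 v, v \in vs & value f u = value f v.
Proof.
split=> H f.
  have [|v] := H f (value f u); first by exists u => //=; rewrite inE.
  by rewrite /= inE /= => vvs <-; exists v.
move=> _ [u' u'u <-]; move: u'u; rewrite /= inE => /eqP ->.
by have [v vvs ->] := H f; exists v => //=; rewrite inE.
Qed.

Lemma identity_among u v : (u ≐ v) = among u [:: v].
Proof. by congr (_, _); apply/fsetP => w; rewrite !inE orbF. Qed.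

Lemma incl_class1 c : incl_class [:: c] = [set S | satisfies S c].
Proof.
rewrite predeqE => S; split=> [H|H c']; first by apply: H; rewrite inE.
by rewrite inE => /eqP ->.
Qed.

Lemma incl_class_cat s t : incl_class (s ++ t) = incl_class s `&` incl_class t.
Proof.
rewrite predeqE => S; split=> [H|[Hs Ht] c].
  by split=> c cs; apply: H; rewrite mem_cat cs ?orbT.
by rewrite mem_cat => /orP[]; [exact: Hs|exact: Ht].
Qed.

Lemma incl_class_cons c s :
  incl_class (c :: s) = [set S | satisfies S c] `&` incl_class s.
Proof. by rewrite -cat1s incl_class_cat incl_class1. Qed.

Local Notation "''x'" := (letter 0) (at level 0).
Local Notation "''y'" := (letter 1) (at level 0).
Local Notation "''z'" := (letter 2) (at level 0).
Local Notation "''w'" := (letter 3) (at level 0).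
Local Notation "''p'" := (letter 4) (at level 0).
Local Notation "''q'" := (letter 5) (at level 0).

(** * The defining identities, elementwise *)

Section Identities.
Variable S : semigroup.
Implicit Types x y z w p q : S.
Local Open Scope group_scope.

Definition env x y z w p q : nat -> S := nth x [:: x; y; z; w; p; q].

Lemma identityP u v :
  satisfies S (u ≐ v) <-> forall f : nat -> S, value f u = value f v.
Proof.
rewrite identity_among satisfies_amongP; split=> H f.
  by have [w] := H f; rewrite inE => /eqP ->.
by exists v; rewrite ?inE.
Qed.

Lemma LcP : Lc S <-> forall x y, x * y = x.
Proof.
rewrite /Lc incl_class1 /= identityP; split=> [H x y|H f]; last exact: H.
exact: H (env x y x x x x).
Qed.

Lemma RcP : Rc S <-> forall x y, x * y = y.
Proof.
rewrite /Rc incl_class1 /= identityP; split=> [H x y|H f]; last exact: H.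
exact: H (env x y x x x x).
Qed.

Lemma ZcP : Zc S <-> forall x y z w, x * y = z * w.
Proof.
rewrite /Zc incl_class1 /= identityP; split=> [H x y z w|H f]; last exact: H.
exact: H (env x y z w x x).
Qed.

Lemma ILP : IL S <-> forall x y z w, x * y * z = x * w.
Proof.
rewrite /IL incl_class1 /= identityP; split=> [H x y z w|H f]; last exact: H.
exact: H (env x y z w x x).
Qed.

Lemma IRP : IR S <-> forall x y z w, x * y * z = w * z.
Proof.
rewrite /IR incl_class1 /= identityP; split=> [H x y z w|H f]; last exact: H.
exact: H (env x y z w x x).
Qed.

Lemma GLP : GL S <-> forall x y z, x * y * z = x * y.
Proof.
rewrite /GL incl_class1 /= identityP; split=> [H x y z|H f]; last exact: H.
exact: H (env x y z x x x).
Qed.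

Lemma GRP : GR S <-> forall x y z, x * y * z = y * z.
Proof.
rewrite /GR incl_class1 /= identityP; split=> [H x y z|H f]; last exact: H.
exact: H (env x y z x x x).
Qed.

Lemma RBP : RB S <-> forall x y, x * y * x = x.
Proof.
rewrite /RB incl_class1 /= identityP; split=> [H x y|H f]; last exact: H.
exact: H (env x y x x x x).
Qed.

Lemma IRBP : IRB S <-> forall x y z, x * y * z = x * z.
Proof.
rewrite /IRB incl_class1 /= identityP; split=> [H x y z|H f]; last exact: H.
exact: H (env x y z x x x).
Qed.

Lemma GRBlP : GRBl S <->
  (forall x y z w, x * y * z = x * y * w * z) /\
  (forall x y, x * y = x * y * x * y).
Proof.
rewrite /GRBl incl_class_cons incl_class1 /setI /= !identityP.
split=> -[H1 H2]; split.
- by move=> x y z w; exact: H1 (env x y z w x x).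
- by move=> x y; exact: H2 (env x y x x x x).
- by move=> f; exact: H1.
- by move=> f; exact: H2.
Qed.

Lemma GRBrP : GRBr S <->
  (forall x y z w, x * y * z = x * w * y * z) /\
  (forall x y, x * y = x * y * x * y).
Proof.
rewrite /GRBr incl_class_cons incl_class1 /setI /= !identityP.
split=> -[H1 H2]; split.
- by move=> x y z w; exact: H1 (env x y z w x x).
- by move=> x y; exact: H2 (env x y x x x x).
- by move=> f; exact: H1.
- by move=> f; exact: H2.
Qed.

End Identities.

Lemma trivial_classP (S : semigroup) : trivial_class S <-> forall x y : S, x = y.
Proof.
split=> [[a H] x y|H]; first by rewrite (H x) (H y).
by case: (carrier_inhabited S) => a; exists a.
Qed.

(** * Inclusions among the classes *)

Lemma RB_IRB : RB `<=` IRB.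
Proof.
move=> S /RBP H; apply/IRBP => x y z.
(* Expanding [z] to [z * x * z] makes [x * (y * z) * x] appear, which collapses to [x]. *)
by rewrite -{1}(H z x) !mulgA -(mulgA x y) H.
Qed.

Lemma IL_IRB : IL `<=` IRB.
Proof. by move=> S /ILP H; apply/IRBP => x y z; exact: H. Qed.

Lemma IL_GL : IL `<=` GL.
Proof. by move=> S /ILP H; apply/GLP => x y z; exact: H. Qed.

Lemma Lc_IL : Lc `<=` IL.
Proof. by move=> S /LcP H; apply/ILP => x y z w; rewrite !H. Qed.

Lemma Lc_RB : Lc `<=` RB.
Proof. by move=> S /LcP H; apply/RBP => x y; rewrite !H. Qed.

Lemma Zc_IL : Zc `<=` IL.
Proof. by move=> S /ZcP H; apply/ILP => x y z w; exact: H. Qed.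

Lemma GL_GRBl : GL `<=` GRBl.
Proof. by move=> S /GLP H; apply/GRBlP; split=> *; rewrite !H. Qed.

Lemma IRB_GRBl : IRB `<=` GRBl.
Proof. by move=> S /IRBP H; apply/GRBlP; split=> *; rewrite !H. Qed.

(** * Normal forms of words in [GRBl] *)

Section NormalForm.
Variables (S : semigroup) (SG : GRBl S).
Local Open Scope group_scope.

Lemma mulg_skip (x y z w : S) : x * y * w * z = x * y * z.
Proof. by move/GRBlP: SG => [H _]; rewrite [RHS](H _ _ _ w). Qed.

(** Inserting [x] between the two factors [y] gives [x * y * x * y], which the second identity
    contracts. *)
Lemma mulg_dup (x y : S) : x * y * y = x * y.
Proof. by rewrite -(mulg_skip _ _ _ x); move/GRBlP: SG => [_ <-]. Qed.

(** Letters strictly between the second and the last can be skipped. In a two-letter word the last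
    letter is the second one, and [mulg_dup] absorbs its repetition. *)
Lemma value_nf (f : nat -> S) i j s :
  value f (i, j :: s) = f i * f j * f (last j s).
Proof.
elim/last_ind: s => [|s k IH]; first by rewrite mulg_dup.
by rewrite last_rcons -(mulg_skip _ _ _ (f (last j s))) -IH /value /= foldl_rcons.
Qed.

End NormalForm.

(** * Generic semigroups *)

Definition entails (J : set semigroup) (u v : word) : Prop :=
  forall S, J S -> forall f : nat -> S, value f u = value f v.

(* In a generic member of [J], an inclusion holds only because one of the
   identities it offers holds in the whole of [J]. *)
Definition generic (J : set semigroup) (S : semigroup) : Prop :=
  forall u, exists g : nat -> S,
    forall v, value g u = value g v -> entails J u v.

(** Satisfaction lets the word on the right vary with the assignment; the generic assignment for [u]
    fixes one that serves the whole of [J]. *)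
Lemma generic_among J S u vs : generic J S -> satisfies S (among u vs) ->
  exists2 v, v \in vs & entails J u v.
Proof.
move=> JS /satisfies_amongP uvs; have [g gP] := JS u.
by have [v vvs /gP] := uvs g; exists v.
Qed.

Lemma generic_satisfies J S c : generic J S -> satisfies S c ->
  forall T, J T -> satisfies T c.
Proof.
move=> JS Sc T JT f _ [u uc <-]; have [g gP] := JS u.
have [|v vc gv] := Sc g (value g u); first by exists u.
by exists v => //; rewrite (gP v _ T JT).
Qed.

Lemma neq_or (T : Type) (x y z : T) : y <> z -> x <> y \/ x <> z.
Proof. by have [->|] := EM (x = y); [right|left]. Qed.

Lemma value_Lc (S : semigroup) (f : nat -> S) u : Lc S -> value f u = f u.1.
Proof.
by case: u => i s /LcP H; rewrite /value; elim: s => //= j s IH; rewrite H.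
Qed.

Lemma value_Zc (S : semigroup) (f : nat -> S) i j s (x y : S) :
  Zc S -> value f (i, j :: s) = (x * y)%g.
Proof.
move=> SZ; rewrite value_nf; last by exact/GL_GRBl/IL_GL/Zc_IL.
by move/ZcP: SZ; apply.
Qed.

Section Generic.
Variable S : semigroup.
Implicit Types a b c d e p q x y z : S.
Local Open Scope group_scope.

Lemma generic_trivial : generic trivial_class S.
Proof.
move=> u; case: (carrier_inhabited S) => a; exists (fun=> a) => v _ T.
by move=> /trivial_classP H f; exact: H.
Qed.

Lemma generic_Lc : ~ trivial_class S -> Lc S -> generic Lc S.
Proof.
move=> /trivial_classP/existsNP[a /existsNP[b ab]] SL u.
exists (fun k => if k == u.1 then a else b) => v; rewrite !value_Lc // eqxx.
by case: eqP => // vu _ T TL f; rewrite !value_Lc // vu.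
Qed.

Lemma generic_Zc : ~ trivial_class S -> Zc S -> generic Zc S.
Proof.
move=> /trivial_classP/existsNP[a /existsNP[b ab]] SZ.
(* All products are equal, and one of two distinct elements differs from their common value. *)
have [c cc] : exists c, c <> c * c.
  have [ca|ba] := neq_or (a * a) ab; first by exists a => aa; apply: ca.
  by exists b => bb; apply: ba; rewrite bb; move/ZcP: SZ; apply.
case=> i [|j s].
  exists (fun k => if k == i then c else c * c) => -[k [|l t]].
    by rewrite /value /= eqxx; case: eqP => // ->.
  by rewrite (value_Zc _ _ _ _ c c SZ) /value /= eqxx.
exists (fun=> c) => -[k [|l t]]; rewrite (value_Zc _ _ _ _ c c SZ).
  by rewrite /value /= => /esym.
by move=> _ T TZ f; rewrite !(value_Zc _ _ _ _ (f 0) (f 0) TZ).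
Qed.

Lemma generic_IL : ~ Lc S -> ~ Zc S -> IL S -> generic IL S.
Proof.
move=> nL nZ SIL; have /ILP SE := SIL.
have mulg_first x y z : x * y = x * z by rewrite -(SE x x x y) (SE _ _ _ z).
have value_IL (T : semigroup) (f : nat -> T) i j s (c : T) :
    IL T -> value f (i, j :: s) = f i * c.
  move=> TIL; rewrite value_nf; last exact/GL_GRBl/IL_GL.
  by move/ILP: TIL; apply.
(* A product depends on its left factor only, so an idempotent [a] would satisfy [a * b = a]. *)
have [a aa] : exists a, a <> a * a.
  have /LcP/existsNP[a /existsNP[b ab]] := nL; exists a => aa; apply: ab.
  by rewrite [RHS]aa; exact: mulg_first.
have [b bb] : exists b, b * b <> a * a.
  apply: contrapT => /forallNP H; apply: nZ; apply/ZcP => x y z w.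
  have E c d : c * d = a * a by have /contrapT <- := H c; exact: mulg_first.
  by rewrite !E.
case=> i [|j s].
  exists (fun k => if k == i then a else a * a) => -[k [|l t]].
    by rewrite /value /= eqxx; case: eqP => // ->.
  rewrite (value_IL _ _ _ _ _ a SIL) /value /= eqxx; case: eqP => // _.
  by rewrite (SE _ _ _ a) => /aa.
(* No letter takes the value [a * a] of the word, and among longer words this value reveals the
   first letter [i]. *)
exists (fun k => if k == i then a else b * b) => -[k [|l t]].
  rewrite (value_IL _ _ _ _ _ a SIL) /value /= eqxx.
  by case: eqP => [_|_] // /esym.
rewrite !(value_IL _ _ _ _ _ a SIL) eqxx; case: eqP => [-> _ T TIL f|_].
  by rewrite !(value_IL _ _ _ _ _ (f 0) TIL).
by rewrite (SE _ _ _ b) => /esym.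
Qed.

Lemma generic_RB : ~ Lc S -> ~ Rc S -> RB S -> generic RB S.
Proof.
move=> nL nR SRB.
have value_RB (T : semigroup) (f : nat -> T) u :
    RB T -> value f u = f u.1 * f (last u.1 u.2).
  move=> TRB; have /RB_IRB TI := TRB; case: u => i [|j s] /=.
    by move/RBP: TRB => E; rewrite -[LHS](E _ (f i)) mulg_dup //; exact: IRB_GRBl.
  by rewrite value_nf; [move/IRBP: TI; apply|exact: IRB_GRBl].
have /RB_IRB/IRBP SE := SRB.
have idem x : x * x = x by rewrite -(SE x x); move/RBP: SRB.
have /LcP/existsNP[e /existsNP[q eq]] := nL.
have /RcP/existsNP[p /existsNP[d pd]] := nR.
(* View a rectangular band as the product of a left zero and a right zero band: [d] and [p] differ
   in the left coordinate and mark the first letter, [e] and [q] differ in the right one and mark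
   the last. *)
case=> i s; exists (fun k => (if k == i then d else p) *
                              (if k == last i s then e else q)).
move=> [j t]; rewrite !value_RB //= !eqxx !mulgA => uv T TRB f.
rewrite !value_RB //=; congr (f _ * f _).
  move/(congr1 (fun x => x * d)): uv; rewrite !SE idem.
  by case: eqP => // _ /esym.
move/(congr1 (fun x => e * x)): uv; rewrite !mulgA !SE idem.
by case: eqP => // _ /esym.
Qed.

Lemma generic_IRB : ~ RB S -> ~ IL S -> ~ IR S -> IRB S -> generic IRB S.
Proof.
move=> nRB nIL nIR SI; have /IRBP SE := SI.
have value_IRB (T : semigroup) (f : nat -> T) i j s :
    IRB T -> value f (i, j :: s) = f i * f (last j s).
  move=> TI; rewrite value_nf; last exact: IRB_GRBl.
  by move/IRBP: TI; apply.
have /RBP/existsNP[a /existsNP[b aba]] := nRB.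
(* Products are idempotent in [IRB], so [a = c * d] would give [a * b * a = a * a = a]. *)
have aa c d : a <> c * d.
  by move=> cd; apply: aba; rewrite SE [RHS]cd {1 2}cd mulgA !SE.
have [e [q eq]] : exists e q, e * a <> e * q.
  apply: contrapT => /forallNP H; apply: nIL; apply/ILP => x y z w.
  by have /forallNP/(_ _)/contrapT E := H x; rewrite SE -!E.
have [d [p pd]] : exists d p, a * d <> p * d.
  apply: contrapT => /forallNP H; apply: nIR; apply/IRP => x y z w.
  by have /forallNP/(_ _)/contrapT E := H z; rewrite SE -!E.
case=> i [|j s].
  exists (fun k => if k == i then a else a * a) => -[k [|l t]].
    by rewrite /value /= eqxx; case: eqP => [->|_ /aa].
  by rewrite [X in X = _]/value /= eqxx value_IRB // => /aa.
set m := last j s.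
(* A letter that is both first and last keeps the non-product [a]. Any other is a product whose left
   factor tells whether it is [i] and whose right factor tells whether it is [m]; multiplying by [d]
   on the right or [e] on the left reads these off. *)
pose g k := if (k == i) && (k == m) then a else
  (if k == i then a else p) * (if k == m then a else q).
have gl k : g k * d = (if k == i then a else p) * d.
  by rewrite /g; case: eqP; case: eqP; rewrite /= ?SE.
have gr k : e * g k = e * (if k == m then a else q).
  by rewrite /g; case: eqP; case: eqP; rewrite /= ?mulgA ?SE.
exists g => -[k t]; rewrite value_IRB // -/m => uv.
have : e * (g i * g m) = e * value g (k, t) by rewrite uv.
have : (g i * g m) * d = value g (k, t) * d by rewrite uv.
case: t uv => [|l t]; last first.
  rewrite value_IRB // mulgA !SE !gl !mulgA !SE !gr !eqxx => _.
  case: eqP => // ki _; case: eqP => // lm _ T TI f.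
  by rewrite !value_IRB // ki lm.
rewrite [value _ _]/(g k) mulgA !SE !gl !gr !eqxx => uv.
case: eqP => // ki _; case: eqP => // km _.
have gk : g k = a by rewrite /g -km -ki !eqxx.
by have := etrans uv gk => /esym/aa.
Qed.

(** * Reading off the first two letters in a member of [GRBl] *)

Section TwoLetters.
Hypothesis SG : GRBl S.

(** The distinct products [a * y * z] and [a * z = a * z * z] cannot both equal [a * a * z], which
    yields a candidate for [b]. Its square gives the same product and is idempotent. *)
Lemma GRBl_not_IRB : ~ IRB S ->
  exists a b e, a * a * e <> a * b * e /\ b * b = b.
Proof.
move=> /IRBP/existsNP[a /existsNP[y /existsNP[z ayz]]].
have [b ab] : exists b, a * a * z <> a * b * z.
  have : a * y * z <> a * z * z by rewrite mulg_dup.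
  by move=> /(neq_or (a * a * z))[|]; [exists y|exists z].
exists a, (b * b), z; split; last by rewrite mulgA !mulg_dup.
by rewrite mulgA mulg_skip.
Qed.

Variables a b e : S.
Hypotheses (abe : a * a * e <> a * b * e) (bb : b * b = b).

(* In a word starting with the letters [i j], only the first letter acts
   nontrivially on what follows it. The letters other than [i] are sent to
   [b * b] or [a * a], which tells whether they are [j], times a factor [q k]
   left free to control the last letter of the word. *)
Definition probe (i j : nat) (q : nat -> S) (k : nat) : S :=
  if k == i then a else (if (k == j) (+) (i == j) then b else a * a) * q k.

(** If [a = c * d], both sides of [abe] reduce to [c * d * e]. *)
Lemma probe_prime c d : a <> c * d.
Proof. by move=> E; apply: abe; rewrite E !mulgA !(mulg_skip SG). Qed.

Let aaae : a * a * a * e = a * a * e.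
Proof. exact: mulg_skip. Qed.

Let aabe : a * a * b * e = a * a * e.
Proof. exact: mulg_skip. Qed.

Let be_aae : b * e <> a * a * e.
Proof. by move=> E; apply: abe; rewrite -[RHS]mulgA E !mulgA aaae. Qed.

Let be_abe : b * e <> a * b * e.
Proof. by move=> E; apply: abe; rewrite -[RHS]mulgA E !mulgA aabe. Qed.

Section Probe.
Variables (i j : nat) (q : nat -> S).
Local Notation h := (probe i j q).

Lemma probe1 : h i = a.
Proof. by rewrite /probe eqxx. Qed.

(** Writing [b] as [b * b] leaves [q k] in third position, where the further factor [c] makes it
    skippable. *)
Let probeM k c : k != i ->
  h k * c = (if (k == j) (+) (i == j) then b else a * a) * c.
Proof.
rewrite /probe => /negPf ->; case: ifP => _; last by rewrite mulg_skip.
by rewrite -{1}bb mulg_skip // bb.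
Qed.

(** The exclusive or makes the second position read [b] for the letter [j] alone if [i <> j], and
    for every letter but [i] if [i = j]. Either way [j] is the only letter with its value. *)
Let probe2 l : a * h l * e =
  if (l != i) && ((l == j) (+) (i == j)) then a * b * e else a * a * e.
Proof.
have [->|li] := eqVneq l i; first by rewrite probe1.
by rewrite -mulgA probeM //; case: ifP; rewrite !mulgA.
Qed.

Let probe_first : h i * h j * e = if i == j then a * a * e else a * b * e.
Proof. by rewrite probe1 probe2 eqxx (eq_sym j) addTb; case: eqP. Qed.

(** The left side is [b * e] or [a * a * e]; the latter occurs only for [i <> j], where the right
    side is [a * b * e]. *)
Let probe_other k : k != i -> h k * e <> h i * h j * e.
Proof.
move=> ki; rewrite probeM // probe_first; have [<-|ij] := eqVneq i j.
  by rewrite (negPf ki).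
by case: ifP => _ // /abe.
Qed.

Lemma probe_letter k c : h k <> h i * h j * c.
Proof.
have [->|ki E] := eqVneq k i; first by rewrite {1}probe1; exact: probe_prime.
by apply: (probe_other ki); rewrite E mulg_skip.
Qed.

Lemma probe_inj k l : h i * h j * e = h k * h l * e -> (i, j) = (k, l).
Proof.
have [->|ki] := eqVneq k i; last first.
  move=> E; exfalso; apply: (probe_other ki).
  rewrite E probeM // probeM //; case: ifP => _; last by rewrite mulg_skip.
  by rewrite -bb mulg_skip.
rewrite probe_first {1}probe1 probe2; have [<-|ij] := eqVneq i j.
  by have [->|li] := eqVneq l i; rewrite ?(negPf li) //= => /abe.
have [->|li] := eqVneq l i; first by move=> /esym/abe.
by have [->|lj] := eqVneq l j => //= /esym/abe.
Qed.

End Probe.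
End TwoLetters.

Lemma generic_GL : ~ IL S -> GL S -> generic GL S.
Proof.
move=> nIL SGL; have SG := GL_GRBl SGL.
have value_GL (T : semigroup) (f : nat -> T) i j s :
    GL T -> value f (i, j :: s) = f i * f j.
  by move=> TGL; rewrite value_nf; [move/GLP: TGL; apply|exact: GL_GRBl].
have /(GRBl_not_IRB SG)[a [b [e [abe bb]]]] : ~ IRB S.
  move=> /IRBP SI; apply: nIL; apply/ILP => x y z w.
  by move/GLP: SGL => SE; rewrite SE -(SE _ _ w).
have aP := probe_prime SG abe.
case=> i [|j s].
  exists (fun k => if k == i then a else a * a) => -[k [|l t]].
    by rewrite /value /= eqxx; case: eqP => [->|_ /aP].
  by rewrite [X in X = _]/value /= eqxx value_GL // => /aP.
(* The last letter of a longer word is invisible in [GL], so a constant [q] suffices. *)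
exists (probe a b i j (fun=> e)) => -[k [|l t]]; rewrite value_GL //.
  by rewrite -(mulg_dup SG) => /esym/(probe_letter SG abe bb).
rewrite value_GL // => /(congr1 (fun x => x * e)) /(probe_inj SG abe bb)[-> ->].
by move=> T TGL f; rewrite !value_GL.
Qed.

Lemma generic_GRBl : ~ IRB S -> ~ GL S -> GRBl S -> generic GRBl S.
Proof.
move=> nIRB nGL SG; have [a [b [e [abe bb]]]] := GRBl_not_IRB SG nIRB.
have aP := probe_prime SG abe.
(* If the third position never told anything from [a], placing [z] and [y] there would give
   [x * y * z = x * y * y = x * y]. *)
have [c [d [p cdp]]] : exists c d p, c * d * a <> c * d * p.
  apply: contrapT => H; apply: nGL; apply/GLP => x y z.
  rewrite -[RHS](mulg_dup SG).
  have E w : x * y * a = x * y * w.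
    by apply: contrapT => K; apply: H; exists x, y, w.
  by rewrite -!E.
case=> i [|j s].
  exists (fun k => if k == i then a else a * a) => -[k [|l t]].
    by rewrite /value /= eqxx; case: eqP => [->|_ /aP].
  by rewrite [X in X = _]/value /= eqxx value_nf // => /aP.
set m := last j s.
(* Behind the prefix [c * d] only [q k] survives, while [i] itself yields [a]. The exclusive or
   swaps [a] and [p] when the last letter [m] is [i], so [m] is singled out in both cases. *)
pose q k := if (k == m) (+) (i == m) then p else a.
set g := probe a b i j q.
have gl k : c * d * g k = c * d * if k == i then a else q k.
  by rewrite /g /probe; case: ifP => //; rewrite mulgA mulg_skip.
have g_inj k : c * d * g m = c * d * g k -> m = k.
  rewrite !gl /q eqxx addTb (eq_sym m i).
  have [<-|im] := eqVneq i m; first by have [->|ki] := eqVneq k i => // /cdp.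
  have [->|ki] := eqVneq k i; first by move/esym/cdp.
  by have [->|km] := eqVneq k m => // /esym/cdp.
exists g => -[k [|l t]]; rewrite value_nf // -/m.
  by move/esym/(probe_letter SG abe bb).
rewrite value_nf // => uv.
have /g_inj ml : c * d * g m = c * d * g (last l t).
  by move: (congr1 (fun x => c * d * x) uv); rewrite !mulgA !(mulg_skip SG).
have := congr1 (fun x => x * e) uv.
rewrite !(mulg_skip SG) => /(probe_inj SG abe bb)[ik jl] T TG f.
by rewrite !value_nf // -/m ml ik jl.
Qed.

End Generic.

(** * Left-right duality *)

Definition opposite (S : semigroup) : semigroup :=
  @MkSemigroup S (fun x y => (y * x)%g)
    (fun x y z => esym (mulgA z y x)) (carrier_inhabited S).

Lemma oppositeK : involutive opposite.
Proof.
by case=> T m mA T0; congr MkSemigroup; exact: Prop_irrelevance.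
Qed.

Definition reverse (u : word) : word :=
  (last u.1 u.2, rev (belast u.1 u.2)).

Lemma value_cons (S : semigroup) (f : nat -> S) i j s :
  value f (i, j :: s) = (f i * value f (j, s))%g.
Proof.
rewrite /value /=; elim/last_ind: s => [//|s k IH].
by rewrite !foldl_rcons IH mulgA.
Qed.

Lemma value_opposite (S : semigroup) (f : nat -> S) u :
  @value (opposite S) f (reverse u) = value f u.
Proof.
case: u => i s; elim/last_ind: s => [//|s k IH].
rewrite /reverse /= last_rcons belast_rcons [i :: s]lastI rev_rcons value_cons.
by rewrite [value _ (_, rev _)]IH /value /= foldl_rcons.
Qed.

Lemma generic_opposite J J' S : (forall T, J' T -> J (opposite T)) ->
  generic J (opposite S) -> generic J' S.
Proof.
move=> JJ' JS u; have [g gP] := JS (reverse u); exists g => v uv T J'T f.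
have /gP/(_ _ (JJ' _ J'T) f) : @value (opposite S) g (reverse u)
  = @value (opposite S) g (reverse v) by rewrite !value_opposite.
by rewrite !value_opposite.
Qed.

Lemma satisfies_opposite S u vs :
  satisfies S (among (reverse u) (map reverse vs)) ->
  satisfies (opposite S) (among u vs).
Proof.
move=> /satisfies_amongP H; apply/satisfies_amongP => f.
have [_ /mapP[v vvs ->] uv] := H f; exists v => //.
have E w : @value S f (reverse w) = @value (opposite S) f w.
  exact: (@value_opposite (opposite S)).
by rewrite -!E.
Qed.

(** * The twelve classes and their excluding inclusions *)

Inductive point :=
  P0 | PL | PR | PZ | PIL | PIR | PGL | PGR | PRB | PIRB | PGRBl | PGRBr.

Definition points :=
  [:: P0; PL; PR; PZ; PIL; PIR; PGL; PGR; PRB; PIRB; PGRBl; PGRBr].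

Definition cls (i : point) : set semigroup :=
  match i with
  | P0 => trivial_class | PL => Lc | PR => Rc | PZ => Zc
  | PIL => IL | PIR => IR | PGL => GL | PGR => GR
  | PRB => RB | PIRB => IRB | PGRBl => GRBl | PGRBr => GRBr
  end.

Definition lower_covers (i : point) : seq point :=
  match i with
  | P0 => [::] | PL | PR | PZ => [:: P0]
  | PIL => [:: PL; PZ] | PIR => [:: PR; PZ] | PGL => [:: PIL] | PGR => [:: PIR]
  | PRB => [:: PL; PR] | PIRB => [:: PRB; PIL; PIR]
  | PGRBl => [:: PGL; PIRB] | PGRBr => [:: PGR; PIRB]
  end.

Definition point_eqb (i j : point) : bool :=
  match i, j with
  | P0, P0 | PL, PL | PR, PR | PZ, PZ | PIL, PIL | PIR, PIR | PGL, PGL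
  | PGR, PGR | PRB, PRB | PIRB, PIRB | PGRBl, PGRBl | PGRBr, PGRBr => true
  | _, _ => false
  end.

Lemma point_eqP : Equality.axiom point_eqb.
Proof. by case; case; constructor. Qed.

HB.instance Definition _ := hasDecEq.Build point point_eqP.

Definition dual (i : point) : point :=
  match i with
  | PL => PR | PR => PL | PIL => PIR | PIR => PIL | PGL => PGR | PGR => PGL
  | PGRBl => PGRBr | PGRBr => PGRBl | _ => i
  end.

Lemma dualK : involutive dual.
Proof. by case. Qed.

Lemma cls_opposite i S : cls (dual i) S -> cls i (opposite S).
Proof.
case: i => /=.
- by [].
- by move/RcP => H; apply/LcP => x y; exact: H.
- by move/LcP => H; apply/RcP => x y; exact: H.
- by move/ZcP => H; apply/ZcP => x y z w; exact: H.
- by move/IRP => H; apply/ILP => x y z w; rewrite -[RHS](H z y x w) -mulgA.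
- by move/ILP => H; apply/IRP => x y z w; rewrite -[RHS](H z y x w) -mulgA.
- by move/GRP => H; apply/GLP => x y z; rewrite -[RHS](H z y x) -mulgA.
- by move/GLP => H; apply/GRP => x y z; rewrite -[RHS](H z y x) -mulgA.
- by move/RBP => H; apply/RBP => x y; rewrite -[RHS](H x y) -mulgA.
- by move/IRBP => H; apply/IRBP => x y z; rewrite -[RHS](H z y x) -mulgA.
- move/GRBrP => [H K]; apply/GRBlP; split=> [x y z w|x y].
    by rewrite -!mulgA; exact: H.
  by rewrite -!mulgA; exact: K.
- move/GRBlP => [H K]; apply/GRBrP; split=> [x y z w|x y].
    by rewrite -!mulgA; exact: H.
  by rewrite -!mulgA; exact: K.
Qed.

Lemma opposite_cls i S : cls i (opposite S) -> cls (dual i) S.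
Proof. by rewrite -{1}[i]dualK => /cls_opposite; rewrite oppositeK. Qed.

(* [u \in vs] holds in [cls j] iff not [le i j]; the entry at [P0], which is
   below every point, is a placeholder. *)
Definition excluder (i : point) : word * seq word :=
  match i with
  | P0 => ('x, [:: 'x])
  | PL => ('x * 'y * 'z, [:: 'y * 'z])
  | PR => ('z * 'y * 'x, [:: 'z * 'y])
  | PZ => ('x * 'y * 'x, [:: 'x])
  | PIL => ('x * 'x, [:: 'x; 'y * 'x * 'x])
  | PIR => ('x * 'x, [:: 'x; 'x * 'x * 'y])
  | PGL => ('x * 'y * 'z, [:: 'x * 'w * 'y * 'z])
  | PGR => ('z * 'y * 'x, [:: 'z * 'y * 'w * 'x])
  | PRB => ('x * 'y * 'x, [:: 'x * 'y; 'y * 'x])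
  | PIRB => ('x * 'y * 'x, [:: 'x; 'x * 'y; 'y * 'x])
  | PGRBl => ('x * 'y * 'z, [:: 'x * 'y; 'x * 'w * 'y * 'z])
  | PGRBr => ('z * 'y * 'x, [:: 'y * 'x; 'z * 'y * 'w * 'x])
  end%W.

Definition exclusion (i : point) : inclusion :=
  among (excluder i).1 (excluder i).2.

(** The entries of [excluder] come in mirror pairs. At a self-dual point reversal may permute the
    offered words, hence a comparison of members only. *)
Lemma reverse_excluder i : reverse (excluder i).1 = (excluder (dual i)).1 /\
  {subset (excluder (dual i)).2 <= map reverse (excluder i).2}.
Proof. by split; [case: i|apply/allP; case: i]. Qed.

Lemma exclusion_opposite i S :
  satisfies S (exclusion (dual i)) -> satisfies (opposite S) (exclusion i).
Proof.
move=> /satisfies_amongP H; apply: satisfies_opposite; apply/satisfies_amongP => f.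
have [-> sub] := reverse_excluder i.
by have [v /sub vi uv] := H f; exists v.
Qed.

(** * Every semigroup in the top class is typical of one point *)

Definition typical (i : point) (S : semigroup) : Prop :=
  [/\ cls i S, generic (cls i) S & i <> P0 -> ~ satisfies S (exclusion i)].

Lemma opposite_typical i S : typical i (opposite S) -> typical (dual i) S.
Proof.
move=> [iS gS nS]; split; first exact: opposite_cls.
  by apply: generic_opposite gS => T; exact: cls_opposite.
by move=> i0 /exclusion_opposite; apply: nS => i0'; move: i0; rewrite i0'.
Qed.

Section Typical.
Variable S : semigroup.
Implicit Types x y z w : S.
Local Open Scope group_scope.

(** By genericity the inclusion could hold only through one of the identities it offers, so these
    are refuted one at a time. In the lemmas below each of them would put [S] into a smaller class
    assumed not to contain it. *)
Lemma typicalP i : i != P0 -> cls i S -> generic (cls i) S ->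
  (forall v, v \in (excluder i).2 ->
     ~ forall f : nat -> S, value f (excluder i).1 = value f v) ->
  typical i S.
Proof.
move=> i0 iS gS nv; split=> // _ /(generic_among gS)[v vi uv].
by apply: nv vi _ => f; exact: uv.
Qed.

Lemma typical_P0 : trivial_class S -> typical P0 S.
Proof. by move=> S0; split=> //; exact: generic_trivial. Qed.

Lemma typical_PL : ~ trivial_class S -> Lc S -> typical PL S.
Proof.
move=> n0 SL; apply: typicalP => //; first exact: generic_Lc.
move=> v; rewrite inE => /eqP -> /= H; apply/n0/trivial_classP => x y.
have /LcP SE := SL.
by have := H (env x y x x x x); rewrite /value /= !SE.
Qed.

Lemma typical_PZ : ~ trivial_class S -> Zc S -> typical PZ S.
Proof.
move=> n0 SZ; apply: typicalP => //; first exact: generic_Zc.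
move=> v; rewrite inE => /eqP -> /= H; apply/n0/trivial_classP => x y.
have /ZcP SE := SZ; rewrite -[x](H (fun=> x)) -[y](H (fun=> y)).
exact: SE.
Qed.

Lemma typical_PIL : ~ Lc S -> ~ Zc S -> IL S -> typical PIL S.
Proof.
move=> nL nZ SI; apply: typicalP => //; first exact: generic_IL.
have /ILP SE := SI.
have E x y : x * y = x * x by rewrite -(SE x x x y) (SE _ _ _ x).
move=> v; rewrite !inE => /orP[]/eqP -> /= H.
  by apply/nL/LcP => x y; rewrite E; exact: H (fun=> x).
apply/nZ/ZcP => x y z w; rewrite E -(SE z x x w).
exact: H (env x z x x x x).
Qed.

Lemma typical_PGL : ~ IL S -> GL S -> typical PGL S.
Proof.
move=> nIL SG; apply: typicalP => //; first exact: generic_GL.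
have /GLP SE := SG; move=> v; rewrite !inE => /eqP -> /= H.
apply/nIL/ILP => x y z w; rewrite SE -[LHS](SE x y z).
by rewrite [LHS](H (env x y z w x x)) /value /= !SE.
Qed.

Lemma typical_PRB : ~ Lc S -> ~ Rc S -> RB S -> typical PRB S.
Proof.
move=> nL nR SB; apply: typicalP => //; first exact: generic_RB.
have /RBP SE := SB; move=> v; rewrite !inE => /orP[]/eqP -> /= H.
  apply/nL/LcP => x y; rewrite -[RHS](SE x y).
  by symmetry; exact: H (env x y x x x x).
apply/nR/RcP => x y; rewrite -[RHS](SE y x).
by symmetry; exact: H (env y x x x x x).
Qed.

Lemma typical_PIRB : ~ RB S -> ~ IL S -> ~ IR S -> IRB S -> typical PIRB S.
Proof.
move=> nB nL nR SI; apply: typicalP => //; first exact: generic_IRB.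
have /IRBP SE := SI; move=> v; rewrite !inE => /or3P[]/eqP -> /= H.
- by apply/nB/RBP => x y; exact: H (env x y x x x x).
- apply/nL/ILP => x y z w.
  have E (t t' : S) : t * t' = t * t.
    by rewrite -[RHS](SE _ t'); symmetry; exact: H (env t t' t t t t).
  by rewrite SE !(E x).
- apply/nR/IRP => x y z w.
  have E (t t' : S) : t' * t = t * t.
    by rewrite -[RHS](SE _ t'); symmetry; exact: H (env t t' t t t t).
  by rewrite SE !(E z).
Qed.

Lemma typical_PGRBl : ~ IRB S -> ~ GL S -> GRBl S -> typical PGRBl S.
Proof.
move=> nI nG SG; apply: typicalP => //; first exact: generic_GRBl.
move=> v; rewrite !inE => /orP[]/eqP -> /= H.
  by apply/nG/GLP => x y z; exact: H (env x y z x x x).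
(* The instance of [H] used is [x * z * z = x * y * z * z]. *)
apply/nI/IRBP => x y z; rewrite -(mulg_dup SG x z) -(mulg_skip SG x y z z).
by symmetry; exact: H (env x z z y x x).
Qed.

End Typical.

(** The classes are tried in an order compatible with inclusion, so the first hit comes with the
    failures its lemma requires. *)
Lemma GRBl_typical S : GRBl S -> exists i, typical i S.
Proof.
move=> SG; have [S0|n0] := EM (trivial_class S); first by exists P0; exact: typical_P0.
have [SL|nL] := EM (Lc S); first by exists PL; exact: typical_PL.
have [SR|nR] := EM (Rc S).
  exists (dual PL); apply/opposite_typical/typical_PL; last exact: (@cls_opposite PL).
  by move/(@opposite_cls P0).
have [SZ|nZ] := EM (Zc S); first by exists PZ; exact: typical_PZ.
have [SI|nIL] := EM (IL S); first by exists PIL; exact: typical_PIL.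
have [SI|nIR] := EM (IR S).
  exists (dual PIL); apply/opposite_typical/typical_PIL; last exact: (@cls_opposite PIL).
    by move/(@opposite_cls PL).
  by move/(@opposite_cls PZ).
have [SB|nB] := EM (RB S); first by exists PRB; exact: typical_PRB.
have [SI|nI] := EM (IRB S); first by exists PIRB; exact: typical_PIRB.
have [SGL|nGL] := EM (GL S); first by exists PGL; exact: typical_PGL.
by exists PGRBl; exact: typical_PGRBl.
Qed.

Lemma GRB_typical S : (GRBl `|` GRBr) S -> exists i, typical i S.
Proof.
move=> [/GRBl_typical//|/(@cls_opposite PGRBl)/GRBl_typical[i /opposite_typical]].
by exists (dual i).
Qed.

(** * The order on points, and where each exclusion holds *)

Lemma cls_dual_sub i j : cls i `<=` cls j -> cls (dual i) `<=` cls (dual j).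
Proof. by move=> ij S /cls_opposite/ij/opposite_cls. Qed.

Lemma lower_cover_sub i j : i \in lower_covers j -> cls i `<=` cls j.
Proof.
have P0_sub k : cls P0 `<=` cls k.
  move=> S /trivial_classP H; case: k => /=; first exact/trivial_classP.
  - exact/LcP. - exact/RcP. - exact/ZcP. - exact/ILP. - exact/IRP.
  - exact/GLP. - exact/GRP. - exact/RBP. - exact/IRBP.
  - by apply/GRBlP; split.
  - by apply/GRBrP; split.
case: j => //=; rewrite !inE; do ?[case/orP]; move/eqP => ->.
- exact: (P0_sub PL).
- exact: (P0_sub PR).
- exact: (P0_sub PZ).
- exact: Lc_IL.
- exact: Zc_IL.
- exact: (@cls_dual_sub PL PIL Lc_IL).
- exact: (@cls_dual_sub PZ PIL Zc_IL).
- exact: IL_GL.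
- exact: (@cls_dual_sub PIL PGL IL_GL).
- exact: Lc_RB.
- exact: (@cls_dual_sub PL PRB Lc_RB).
- exact: RB_IRB.
- exact: IL_IRB.
- exact: (@cls_dual_sub PIL PIRB IL_IRB).
- exact: GL_GRBl.
- exact: IRB_GRBl.
- exact: (@cls_dual_sub PGL PGRBl GL_GRBl).
- exact: (@cls_dual_sub PIRB PGRBl IRB_GRBl).
Qed.

Fixpoint below (n : nat) (i : point) : seq point :=
  i :: if n is n'.+1 then flatten (map (below n') (lower_covers i)) else [::].

(* Maximal chains have five points. *)
Definition le (i j : point) : bool := i \in below 4 j.

Lemma le_sub i j : le i j -> cls i `<=` cls j.
Proof.
rewrite /le; elim: 4 j => [|n IH] j; first by rewrite inE => /eqP ->.
rewrite inE => /orP[/eqP -> //|/flatten_mapP].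
move => [k kj /IH ik]; apply: subset_trans ik _.
exact: lower_cover_sub.
Qed.

(* The maximal elements among the points that are not above [i]. *)
Definition avoiding (i : point) : seq point :=
  match i with
  | P0 => [::] | PL => [:: PGR] | PR => [:: PGL] | PZ => [:: PRB]
  | PIL => [:: PRB; PGR] | PIR => [:: PRB; PGL]
  | PGL => [:: PGRBr] | PGR => [:: PGRBl]
  | PRB => [:: PGL; PGR] | PIRB => [:: PGL; PGR; PRB]
  | PGRBl => [:: PGL; PGRBr] | PGRBr => [:: PGR; PGRBl]
  end.

Lemma avoiding_opposite i S :
  (forall k T, k \in avoiding i -> cls k T -> satisfies T (exclusion i)) ->
  forall k, k \in avoiding (dual i) -> cls k S ->
    satisfies S (exclusion (dual i)).
Proof.
move=> H k ki kS; rewrite -[S]oppositeK; apply: exclusion_opposite.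
rewrite dualK; apply: (H (dual k)).
  by case: i {H} ki; case: k {kS}.
by apply: cls_opposite; rewrite dualK.
Qed.

Lemma among_identity (S : semigroup) u v vs : v \in vs ->
  (forall f : nat -> S, value f u = value f v) -> satisfies S (among u vs).
Proof. by move=> vvs uv; apply/satisfies_amongP => f; exists v. Qed.

(** The list holds the self-dual points and one of each dual pair; reversal gives the rest. *)
Lemma avoiding_left i k S : i \in [:: P0; PL; PZ; PIL; PGL; PRB; PIRB; PGRBl] ->
  k \in avoiding i -> cls k S -> satisfies S (exclusion i).
Proof.
have sat j v : v \in (excluder j).2 ->
    (forall f : nat -> S, value f (excluder j).1 = value f v) ->
    satisfies S (exclusion j) by exact: among_identity.
case: i => //= _; rewrite ?inE //; do ?[case/orP]; move/eqP => -> {k} /=.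
- by move/GRP => H; apply: (sat PL ('y * 'z)%W) => // f; exact: H.
- by move/RBP => H; apply: (sat PZ 'x) => // f; exact: H.
- move/RBP => H; apply: (sat PIL 'x) => // f; rewrite /value /=.
  by rewrite -[RHS](H _ (f 0 * f 0)%g) mulgA H.
- by move/GRP => H; apply: (sat PIL ('y * 'x * 'x)%W) => // f; symmetry; exact: H.
- by move/GRBrP => [H _]; apply: (sat PGL ('x * 'w * 'y * 'z)%W) => // f; exact: H.
- by move/GLP => H; apply: (sat PRB ('x * 'y)%W) => // f; exact: H.
- by move/GRP => H; apply: (sat PRB ('y * 'x)%W) => // f; exact: H.
- by move/GLP => H; apply: (sat PIRB ('x * 'y)%W) => // f; exact: H.
- by move/GRP => H; apply: (sat PIRB ('y * 'x)%W) => // f; exact: H.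
- by move/RBP => H; apply: (sat PIRB 'x) => // f; exact: H.
- by move/GLP => H; apply: (sat PGRBl ('x * 'y)%W) => // f; exact: H.
- by move/GRBrP => [H _]; apply: (sat PGRBl ('x * 'w * 'y * 'z)%W) => // f; exact: H.
Qed.

Lemma avoiding_satisfies i k S :
  k \in avoiding i -> cls k S -> satisfies S (exclusion i).
Proof.
case: (boolP (i \in [:: P0; PL; PZ; PIL; PGL; PRB; PIRB; PGRBl])) => [il|ir].
  exact: avoiding_left.
have il : dual i \in [:: P0; PL; PZ; PIL; PGL; PRB; PIRB; PGRBl].
  by case: i ir.
rewrite -[i]dualK; apply: avoiding_opposite => l T; exact: avoiding_left.
Qed.

Lemma not_le_satisfies i j S : ~~ le i j -> cls j S -> satisfies S (exclusion i).
Proof.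
(* A finite check: a point not above [i] lies below a maximal such point. *)
move=> ij jS; have /hasP[k ki jk] : has (le j) (avoiding i).
  by move: ij {jS}; case: i; case: j.
exact: avoiding_satisfies ki (le_sub jk jS).
Qed.

(* Modulo the identities, the last inclusion says that either no left
   translation or no right translation sees the inner letters. *)
Definition GRB_inclusions : seq inclusion :=
  [:: among ('x * 'y) [:: 'x * 'y * 'x * 'y];
      among ('x * 'y * 'z) [:: 'x * 'y * 'w * 'y * 'z];
      among ('x * 'y * 'z * 'w) [:: 'x * 'y * 'p * 'z * 'w];
      among ('x * 'y * 'z * 'w) [:: 'x * 'y * 'p * 'w; 'x * 'q * 'z * 'w]]%W.

(** * A definition of the top class by inclusions *)

Section Top.
Local Open Scope group_scope.

Lemma GRB_inclusionsE : incl_class GRB_inclusions = GRBl `|` GRBr.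
Proof.
have among1 (S : semigroup) u v : satisfies S (among u [:: v]) <->
    forall f : nat -> S, value f u = value f v.
  by rewrite -identity_among identityP.
rewrite predeqE => S; rewrite /GRB_inclusions 3!incl_class_cons incl_class1.
rewrite /setI /setU /= !among1 satisfies_amongP; split=> [[H1 [H2 [H3 H4]]]|].
  have skip (x y z w p : S) : x * y * p * z * w = x * y * z * w.
    by symmetry; exact: H3 (env x y z w p x).
  have dup (x y z : S) : x * y * y * z = x * y * z.
    by rewrite -(skip _ _ _ _ y); symmetry; exact: H2 (env x y z y x x).
  have idem (x y : S) : x * y = x * y * x * y by exact: H1 (env x y x x x x).
  have [Hl|/existsNP[a]] := EM (forall x y z w : S, x * y * z = x * y * w * z).
    by left; apply/GRBlP.
  move=> /existsNP[b /existsNP[c /existsNP[d abcd]]].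
  right; apply/GRBrP; split=> // x y z w.
  (* The failing quadruple [a], [b], [c], [d] is fed in with [x], [y], [w] free. The first
     alternative contradicts [abcd], so the second holds for all [x], [y], [w]. *)
  have [v] := H4 (env x y b c d w); rewrite !inE => /orP[]/eqP -> E.
    have {}E : x * y * b * c = x * y * d * c := E.
    case: abcd; rewrite -(dup a b c) -(skip a b b c (x * y)) -(skip a b d c (x * y)).
    by rewrite -!mulgA in E *; rewrite E.
  have {}E : x * y * b * c = x * w * b * c := E.
  (* The product [b * c] is inserted behind [x * y], which lets [E] exchange [y] for [w], and is
     then removed. *)
  rewrite -(dup x y z) -(skip x y y z (b * c)) -(skip x w y z (b * c)).
  by rewrite !mulgA E.
move=> [SG|/GRBrP[E idem]].
  split; first by move=> f; have /GRBlP[_] := SG; apply.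
  split; first by move=> f; rewrite /value /= !(mulg_skip SG).
  split; first by move=> f; rewrite /value /= !(mulg_skip SG).
  move=> f; exists ('x * 'y * 'p * 'w)%W; first by rewrite inE eqxx.
  by rewrite /value /= !(mulg_skip SG).
split; first by move=> f; exact: idem.
split; first by move=> f; rewrite /value /= (E _ _ _ (f 1%N * f 3%N)) mulgA.
split; first by move=> f; rewrite /value /= -E (E _ _ _ (f 1%N * f 4%N)) mulgA.
move=> f; exists ('x * 'q * 'z * 'w)%W; first by rewrite !inE eqxx orbT.
by rewrite /value /= -!E.
Qed.

End Top.

(** * Unions of the twelve classes *)

Definition join (l : seq point) : set semigroup :=
  foldl (fun A i => A `|` cls i) (cls (head P0 l)) (behead l).

Lemma foldl_setU (T : Type) (I : eqType) (F : I -> set T) A l x :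
  foldl (fun A i => A `|` F i) A l x <-> A x \/ exists2 i, i \in l & F i x.
Proof.
elim: l A => [|i l IH] A /=; first by split=> [Ax|[//|[k]//]]; left.
rewrite IH; split=> [[[Ax|Fx]|[k kl Fx]]|[Ax|[k]]].
- by left.
- by right; exists i; rewrite ?inE ?eqxx.
- by right; exists k; rewrite // inE kl orbT.
- by left; left.
- rewrite inE => /orP[/eqP -> Fx|kl Fx]; first by left; right.
  by right; exists k.
Qed.

Lemma joinP l S : l != [::] -> join l S <-> exists2 k, k \in l & cls k S.
Proof.
case: l => // i l _; rewrite /join foldl_setU /=; split=> [[iS|[k kl kS]]|[k]].
- by exists i; rewrite ?inE ?eqxx.
- by exists k; rewrite // inE kl orbT.
- rewrite inE => /orP[/eqP -> iS|kl kS]; first by left.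
  by right; exists k.
Qed.

Definition unions : seq (seq point) :=
  [:: [:: P0]; [:: PL]; [:: PR]; [:: PL; PR];
      [:: PZ]; [:: PL; PZ]; [:: PZ; PR]; [:: PL; PZ; PR];
      [:: PIL]; [:: PIR]; [:: PIL; PR]; [:: PL; PIR]; [:: PIL; PIR];
      [:: PGL]; [:: PGR]; [:: PGL; PR]; [:: PL; PGR]; [:: PGL; PIR];
      [:: PIL; PGR]; [:: PGL; PGR];
      [:: PRB]; [:: PZ; PRB]; [:: PIL; PRB]; [:: PRB; PIR];
      [:: PIL; PRB; PIR]; [:: PGL; PRB]; [:: PRB; PGR]; [:: PGL; PRB; PIR];
      [:: PIL; PRB; PGR]; [:: PGL; PRB; PGR];
      [:: PIRB]; [:: PGL; PIRB]; [:: PIRB; PGR]; [:: PGL; PIRB; PGR];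
      [:: PGRBl]; [:: PGRBr]; [:: PGRBl; PGR]; [:: PGL; PGRBr];
      [:: PGRBl; PGRBr]].

(** [join] folds from the head of its list, with no empty union, and [unions] keeps the order of
    [collD], so the two sides are convertible. *)
Lemma collDE : collD =
  foldl (fun E l => E `|` [set join l]) [set join [:: P0]] (behead unions).
Proof. by []. Qed.

Lemma collDP A : collD A <-> exists2 l, l \in unions & A = join l.
Proof.
rewrite collDE foldl_setU -[unions in X in _ <-> X]/([:: P0] :: behead unions).
split=> [[->|[l lu ->]]|[l]].
- by exists [:: P0]; rewrite // inE eqxx.
- by exists l; rewrite // inE lu orbT.
- rewrite inE => /orP[/eqP -> ->|lu ->]; first by left.
  by right; exists l.
Qed.

Lemma mem_points i : i \in points.
Proof. by case: i. Qed.

(** If [S] is typical of [i] and [i] is below no member of [l], then [exclusion i], which [S]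
    violates, is among the imposed inclusions. *)
Lemma joinE l : l != [::] -> join l = incl_class
  (GRB_inclusions ++ [seq exclusion i | i <- points & ~~ has (le i) l]).
Proof.
move=> l0; rewrite incl_class_cat GRB_inclusionsE predeqE => S.
rewrite joinP //; split=> [[k kl kS]|[/GRB_typical[i [iS _ nS]] HS]].
  split; last first.
    move=> _ /mapP[i il ->]; move: il.
    rewrite mem_filter => /andP[/hasPn/(_ k kl) ik _].
    exact: not_le_satisfies ik kS.
  have /orP[/le_sub kS'|/le_sub kS'] : le k PGRBl || le k PGRBr.
    by case: k {kl kS}.
  - by left; exact: kS'.
  - by right; exact: kS'.
have [/hasP[k kl ik]|il] := boolP (has (le i) l).
  by exists k => //; exact: le_sub ik S iS.
case: nS; last by apply: HS; apply: map_f; rewrite mem_filter il mem_points.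
(* The placeholder at [P0] does no harm: [P0] lies below the first point of the nonempty list. *)
move=> i0; move/negP: il; apply; rewrite i0.
by case: l l0 {HS} => // k l _; apply/orP; left; case: k.
Qed.

Lemma join_inclusion_class l : l != [::] -> semigroup_inclusion_class (join l).
Proof.
move=> l0; rewrite joinE //; eexists; split; last by [].
  by rewrite /GRB_inclusions.
have among_nonempty u v vs : (among u (v :: vs)).1 != fset0 /\
    (among u (v :: vs)).2 != fset0.
  by split; apply/fset0Pn; [exists u|exists v]; rewrite !inE ?eqxx.
move=> c; rewrite mem_cat => /orP[|/mapP[i _ ->]]; last first.
  by case: i; exact: among_nonempty.
by rewrite /GRB_inclusions !inE; do ?[case/orP]; move/eqP => ->; exact: among_nonempty.
Qed.

(** * Enumeration of the down-closed sets *)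

Fixpoint bitseqs (n : nat) : seq bitseq :=
  if n is n'.+1 then [seq b :: s | b <- [:: true; false], s <- bitseqs n']
  else [:: [::]].

Lemma mem_bitseqs s : s \in bitseqs (size s).
Proof.
elim: s => // b s IH; apply/allpairsP; exists (b, s) => /=.
by split=> //; case: b.
Qed.

Definition down_closed (p : pred point) : bool :=
  all (fun j => all (fun i => p j ==> p i) (lower_covers j)) points.

Definition generates (p : pred point) (l : seq point) : bool :=
  all (fun i => p i == has (le i) l) points.

(** A predicate on twelve points is a truth table of length twelve, so computation over all tables
    settles the claim. *)
Lemma down_closed_union (p : pred point) : p P0 -> down_closed p -> has (generates p) unions.
Proof.
pose q (s : bitseq) i := nth false s (index i points).
(* The conditional confines the search through [unions] to down-closed tables. *)
have check : all (fun s => if q s P0 && down_closed (q s)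
    then has (generates (q s)) unions else true) (bitseqs (size points)).
  by vm_compute.
have pq : p =1 q (map p points) by case.
have -> : p = q (map p points) by apply/funext.
move=> p0 pd; have /allP/(_ (map p points)) := check.
by rewrite -{1}(size_map p points) mem_bitseqs p0 pd; apply.
Qed.

Lemma unions_nonempty l : l \in unions -> l != [::].
Proof. by move: l; apply/allP. Qed.

(** * Inclusion classes below the top class *)

Lemma inclusion_class_collD X : semigroup_inclusion_class X ->
  X `<=` GRBl `|` GRBr -> collD X.
Proof.
move=> [s [_ s0 ->]] sub; pose p i := `[< cls i `<=` incl_class s >].
have p0 : p P0.
  (* All words agree in a one-element semigroup, so an inclusion holds as soon as its right side is
     nonempty. *)
  apply/asboolP => S /trivial_classP S0 c /s0[_ /fset0Pn[v vc]] f a _.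
  by exists v => //; exact: S0.
have pd : down_closed p.
  apply/allP => j _; apply/allP => i ij; apply/implyP => /asboolP js.
  by apply/asboolP; apply: subset_trans js; exact: lower_cover_sub.
have /hasP[l lu /allP lp] := down_closed_union p0 pd.
have {}lp i : p i = has (le i) l by apply/eqP/lp/mem_points.
apply/collDP; exists l => //; rewrite predeqE => S.
rewrite joinP ?unions_nonempty //; split=> [Ss|[k kl kS]].
  have [i [iS iG _]] := GRB_typical (sub S Ss).
  have : p i.
    (* Genericity of [S] carries each inclusion defining [X] over to the whole of [cls i]. *)
    by apply/asboolP => T iT c cs; exact: generic_satisfies iG (Ss c cs) T iT.
  by rewrite lp => /hasP[k kl ik]; exists k => //; exact: le_sub ik S iS.
have /asboolP : p k by rewrite lp; apply/hasP; exists k => //; case: (k).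
exact.
Qed.

Lemma collD_inclusion_class A : collD A -> semigroup_inclusion_class A.
Proof.
by move/collDP => [l /unions_nonempty l0 ->]; exact: join_inclusion_class.
Qed.

Lemma collD_sub A : collD A -> A `<=` GRBl `|` GRBr.
Proof.
move/collDP => [l /unions_nonempty l0 ->]; rewrite joinE // incl_class_cat.
by rewrite GRB_inclusionsE; exact: subIsetl.
Qed.

Unset Implicit Arguments.

Theorem theorem30 (n : nat) (hn : (1 <= n)%N)
    (alpha : 'I_n.+1 -> set semigroup) (halpha : path_in collD alpha) :
  (forall X : set semigroup, semigroup_inclusion_class X ->
     alpha ord0 `<` X -> X `<` alpha ord_max -> collD X) /\
  (n = 1%N -> covers_in collD (alpha ord_max) (alpha ord0) ->
     covers (alpha ord_max) (alpha ord0)).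
Proof.
have [_ alphaD] := halpha.
(* The last term of the path lies below the top class, hence so does [X], and the classification
   applies. *)
have mid X : semigroup_inclusion_class X -> X `<` alpha ord_max -> collD X.
  move=> IX [XA _]; apply: inclusion_class_collD => //.
  exact: subset_trans XA (collD_sub (alphaD _)).
split=> [X IX _|_ [D0 D1 lt01 cov]]; first exact: mid.
split=> //; try exact: collD_inclusion_class.
by move=> X IX lt0X ltX1; apply: cov => //; exact: mid.
Qed.
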